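(* Let $E$ be a weakly sequentially complete separable Banach space over $\mathbb{K}\in\{\mathbb{R},\mathbb{C}\}$ and let $((a_n,b_n^* ))_{n\in\mathbb{N}^*}$ be a besselian Schauder frame of $E$. Let $((x_n,y_n^* ))_{n\in\mathbb{N}^*}$ be a sequence in $E\times E^*$ for which there exists a constant $\alpha\in[0,1[$ such that for each $x\in E$ and $y^*\in E^*$ $$\sum_{n=1}^{\infty}\left|y_n^*(x)\,y^*(x_n-a_n)+(y_n^*-b_n^* )(x)\,y^*(a_n)\right|\leq\alpha\|x\|_E\|y^*\|_{E^*}.$$ Then there exist a sequence $(z_n^* )_{n\in\mathbb{N}^*}$ of elements of $E^*$ and a sequence $(w_n)_{n\in\mathbb{N}^*}$ of elements of $E$ such that: (1) $(w_n)_{n\in\mathbb{N}^*}\equiv_E (x_n)_{n\in\mathbb{N}^*}$; (2) $(z_n^* )_{n\in\mathbb{N}^*}\equiv_{E^*}(y_n^* )_{n\in\mathbb{N}^*}$; (3) $((x_n,z_n^* ))_{n\in\mathbb{N}^*}$ and $((w_n,y_n^* ))_{n\in\mathbb{N}^*}$ are besselian Schauder frames of $E$.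
   Context: $E^*$ is the topological dual of $E$ and $\mathbb{N}^*=\{1,2,3,\dots\}$. $E$ is weakly sequentially complete if for each sequence $(u_n)$ in $E$ such that $\lim_n x^*(u_n)$ exists for every $x^*\in E^*$, there is $u\in E$ with $\lim_n x^*(u_n)=x^*(u)$ for every $x^*\in E^*$. A sequence $((a_n,b_n^* ))_{n\in\mathbb{N}^*}$ in $E\times E^*$ is a Schauder frame of $E$ if for every $x\in E$ the series $\sum_n b_n^*(x)a_n$ converges in norm to $x$. It is a besselian Schauder frame of $E$ if in addition there is a constant $A>0$ with $\sum_{n=1}^{\infty}|b_n^*(x)||y^*(a_n)|\le A\|x\|_E\|y^*\|_{E^*}$ for all $x\in E$, $y^*\in E^*$. For sequences $(w_n),(x_n)$ in $E$, $(w_n)\equiv_E(x_n)$ means that there is an isomorphism (of Banach spaces) $T$ from $E$ onto $E$ with $w_n=T(x_n)$ for all $n\in\mathbb{N}^*$. For sequences $(z_n^* ),(y_n^* )$ in $E^*$, $(z_n^* )\equiv_{E^*}(y_n^* )$ means that there is an isomorphism $T$ from $E$ onto $E$ with $z_n^*=y_n^*\circ T$ for all $n\in\mathbb{N}^*$. *)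

(* Defs.v *)
From mathcomp Require Import all_boot all_order all_algebra.
From mathcomp Require Import complex.
From mathcomp Require Import all_classical all_reals all_analysis.

Set Implicit Arguments.
Unset Strict Implicit.
Unset Printing Implicit Defensive.

Import Order.TTheory GRing.Theory Num.Theory.
Import numFieldNormedType.Exports.

Local Open Scope classical_set_scope.
Local Open Scope ring_scope.

(* All sequences indexed by {1, 2, 3, ...} are represented by functions on
   [nat], the entry of index [n] being the mathematical entry [n + 1]. *)

Variant scalar_kind := RealScalars | ComplexScalars.

Definition scalars (R : realType) (k : scalar_kind) : numFieldType :=
  match k with
  | RealScalars => R
  | ComplexScalars => complex R
  end.

Definition real_part (R : realType) (k : scalar_kind) : scalars R k -> R :=
  match k return scalars R k -> R with
  | RealScalars => fun x => x
  | ComplexScalars => fun x => complex.Re x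
  end.

(* In MathComp-Analysis the norm of a scalar or of a vector over [K] takes its
   values in [K]; as these are nonnegative, hence real, no information is lost
   by taking the real part. *)
Definition sabs (R : realType) (k : scalar_kind) (c : scalars R k) : R :=
  real_part `|c|.

Definition rnorm (R : realType) (k : scalar_kind)
  (V : normedModType (scalars R k)) (v : V) : R := real_part `|v|.

Section Banach.
Context {R : realType} {k : scalar_kind}.
Local Notation K := (scalars R k).
Implicit Type E : completeNormedModType K.

Record dual E := Dual {
  dual_fun :> {linear E -> K^o};
  dual_continuous : continuous dual_fun }.

Definition dual_norm E (f : dual E) : R :=
  sup [set sabs (f x) | x in [set x : E | rnorm x <= 1]].

Definition separable E : Prop := exists2 D : set E, countable D & dense D.

Definition weakly_sequentially_complete E : Prop :=
  forall u : nat -> E,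
    (forall f : dual E, cvg (f (u n) @[n --> \oo])) ->
    exists l : E, forall f : dual E, f (u n) @[n --> \oo] --> f l.

Definition schauder_frame E (a : nat -> E) (b : nat -> dual E) : Prop :=
  forall x : E, series (fun n => (b n x : K) *: a n) @ \oo --> x.

(* The series of nonnegative terms is summed in the extended reals, so that
   the inequality also asserts its convergence. *)
Definition besselian_schauder_frame E (a : nat -> E) (b : nat -> dual E) :
    Prop :=
  schauder_frame a b /\
  exists2 A : R, 0 < A & forall (x : E) (f : dual E),
    (\sum_(0 <= n <oo) (sabs (b n x) * sabs (f (a n)))%:E
      <= (A * rnorm x * dual_norm f)%:E)%E.

(* Linearity of the inverse is automatic. *)
Definition banach_automorphism E (T : {linear E -> E}) : Prop :=
  continuous T /\
  exists S : E -> E, [/\ cancel T S, cancel S T & continuous S].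

Definition seq_equiv E (w x : nat -> E) : Prop :=
  exists2 T : {linear E -> E}, banach_automorphism T &
    forall n, w n = T (x n).

Definition dual_seq_equiv E (z y : nat -> dual E) : Prop :=
  exists2 T : {linear E -> E}, banach_automorphism T &
    forall n (x : E), z n x = y n (T x).

End Banach.

(* Main.v *)
From HB Require Import structures.
Require Import Defs.
From mathcomp Require Import all_boot all_order all_algebra.
From mathcomp Require Import complex lra.
From mathcomp Require Import all_classical all_reals all_analysis.

(** Expanding the terms of the hypothesis gives
    [y n u * f (x n) - b n u * f (a n) = f (d n)], where
    [d n = y n u *: x n - b n u *: a n].  The hypothesis thus says that, for
    each [u], the series of the [d n] is weakly unconditionally Cauchy, with
    bound [alpha * rnorm u].  In a separable and weakly sequentially complete
    space such a series converges in norm (Bessaga and Pelczynski; [wuc_series_cvg]).  The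
    frame expansion of [u] converges to [u], so the series of the
    [y n u *: x n] converges as well, to some [T u], and a norming functional
    (Hahn and Banach; [norming_functional]) gives
    [rnorm (T u - u) <= alpha * rnorm u]: this is [perturbed_frame_operator].
    As [alpha < 1], the operator [T] is invertible ([near_id_inverse]); let [S]
    be its inverse.  Inserting [S] on either side repairs the expansion: the
    series of the [y n (S u) *: x n] converges to [T (S u) = u], and that of
    the [y n u *: S (x n)] to [S (T u) = u].  So [z n = y n \o S] and
    [w n = S (x n)] are the required sequences, and their Bessel bounds come
    from that of [(a, b)], the hypothesis and the boundedness of [S].

    The convergence theorem is proved by contradiction.  If the series is not
    Cauchy, grouping its terms into disjoint blocks gives a weakly
    unconditionally Cauchy sequence [s] with norms at least [e > 0]; take
    functionals [f i] of norm at most one with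
    [sabs (f i (s i)) = rnorm (s i)].  Rosenthal's lemma ([rosenthal]) selects
    infinitely many indices for which the matrix of the [f i (s j)] has small
    off-diagonal row sums.  By weak sequential completeness every subseries over
    these indices has a weak sum.  Two distinct subseries differ in some index
    [i], and [f i] sees that their weak sums are at a distance at least [e / 2].
    There are as many subseries as sets of integers, which a separable space
    cannot accommodate ([separable_collision]). *)

Set Implicit Arguments.
Unset Strict Implicit.
Unset Printing Implicit Defensive.
Import Order.TTheory GRing.Theory Num.Theory.
Import numFieldNormedType.Exports.
Local Open Scope classical_set_scope.
Local Open Scope ring_scope.

(** * The Hahn-Banach theorem for a sublinear function *)

Section HahnBanach.
Context {R : realType} {V : lmodType R}.
Variable p : V -> R.
Hypothesis p_subadditive : forall u v, p (u + v) <= p u + p v.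
Hypothesis p_homogeneous : forall t v, 0 <= t -> p (t *: v) = t * p v.

(** Partial functionals are encoded by their graphs, so that the union of a
    chain of extensions needs no gluing. Single-valuedness is a consequence of
    domination: if [(v, s)] and [(v, t)] are in the graph, then so is
    [(0, t - s)], hence [t - s <= p 0 = 0], and likewise [s - t <= 0].
    The second factor is [R^o] to make the product a left module. *)
Definition dominated_graph (G : set (V * R^o)) : Prop :=
  (forall t g h, G g -> G h -> G (t *: g + h)) /\
  (forall g, G g -> g.2 <= p g.1).

(** The value [c] at the new vector [w] has to satisfy
    [g.2 - p (g.1 - w) <= c <= p (h.1 + w) - h.2] for all [g] and [h] in the
    graph. Subadditivity says that every lower bound is at most every upper
    bound, so the supremum of the lower bounds is a possible choice.
    Homogeneity then gives domination on all multiples of [w]. *)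
Lemma dominated_graph_extension (G : set (V * R^o)) (w : V) :
  dominated_graph G -> G 0 ->
  exists c : R, dominated_graph
    [set g | exists2 h, G h & exists s : R, g = h + s *: ((w, c) : V * R^o)].
Proof.
move=> [Glin Gle] G0.
pose L := [set g.2 - p (g.1 - w) | g in G].
have GD g h : G g -> G h -> g.2 + h.2 <= p (g.1 + h.1).
  by move=> Gg Gh; have := Gle _ (Glin 1 _ _ Gg Gh); rewrite scale1r.
have GZ t g : G g -> G (t *: g).
  by move=> Gg; have := Glin t _ _ Gg G0; rewrite addr0.
have Lub h : G h -> ubound L (p (h.1 + w) - h.2).
  move=> Gh _ [g Gg <-].
  have := GD _ _ Gg Gh; have := p_subadditive (g.1 - w) (h.1 + w).
  rewrite addrACA addNr addr0; lra.
have supL : has_sup L.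
  split; first by exists (0 - p (0 - w)), 0.
  by exists (p (0 + w) - 0); exact: Lub _ G0.
pose c := sup L.
have cge g : G g -> g.2 - p (g.1 - w) <= c.
  by move=> Gg; apply: sup_upper_bound => //; exists g.
have cle g : G g -> c <= p (g.1 + w) - g.2.
  by move=> Gg; apply: sup_le_ub; [case: supL | exact: Lub].
exists c; split.
  move=> t _ _ [g Gg [s ->]] [h Gh [r ->]].
  exists (t *: g + h); first exact: Glin.
  by exists (t * s + r); rewrite scalerDr scalerA scalerDl addrACA.
move=> _ [g Gg [s ->]] /=.
change (g.2 + s * c <= p (g.1 + s *: w)).
have [s0|s0|->] := ltgtP s 0; last by rewrite scale0r mul0r !addr0 Gle.
- have r0 : 0 < - s by rewrite oppr_gt0.
  have : (- s)^-1 * g.2 - p ((- s)^-1 *: g.1 - w) <= c := cge _ (GZ _ _ Gg).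
  rewrite -(ler_pM2l r0) mulrBr -(p_homogeneous _ (ltW r0)) scalerBr scalerA.
  rewrite mulrA mulfV ?gt_eqF// scale1r mul1r scaleNr opprK; lra.
- have : c <= p (s^-1 *: g.1 + w) - s^-1 * g.2 := cle _ (GZ _ _ Gg).
  rewrite -(ler_pM2l s0) mulrBr -(p_homogeneous _ (ltW s0)) scalerDr scalerA.
  rewrite mulrA mulfV ?gt_eqF// scale1r mul1r; lra.
Qed.

(** Zorn's lemma is applied to the sets [G] whose union with the graph [G0] of
    [t *: v0 |-> t * p v0] is dominated. Adding [G0] instead of requiring that
    [G] contain it lets the empty chain have the union [set0]. *)
Theorem hahn_banach_norming (v0 : V) :
  exists g : V -> R, [/\ forall t u v, g (t *: u + v) = t * g u + g v,
    forall v, g v <= p v & g v0 = p v0].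
Proof.
have p0 : p 0 = 0 by rewrite -(scale0r 0) p_homogeneous// mul0r.
pose z : V * R^o := (v0, p v0).
pose G0 : set (V * R^o) := range (fun t : R => t *: z).
have G00 : G0 0 by exists 0 => //; rewrite scale0r.
have domG0 : dominated_graph G0.
  split.
    move=> t _ _ [s _ <-] [r _ <-]; exists (t * s + r) => //.
    by rewrite /= scalerDl scalerA.
  (* for t < 0, use 0 = p 0 <= p (t *: v0) + p (- t *: v0) *)
  move=> _ [t _ <-] /=; change (t * p v0 <= p (t *: v0)).
  have [t0|t0] := leP 0 t; first by rewrite p_homogeneous.
  have Nt0 : 0 <= - t by rewrite oppr_ge0 ltW.
  have := p_subadditive (t *: v0) (- t *: v0).
  rewrite (p_homogeneous _ Nt0) -scalerDl subrr scale0r p0; lra.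
have [|A [domA Amax]] := @Zorn_bigcup _ [set G | dominated_graph (G `|` G0)].
  move=> F FP Ftot; split; last first.
    move=> g [[X FX Xg]|]; last exact: domG0.2.
    by apply: (FP _ FX).2; left.
  have join X Y g h t : F X -> F Y -> (X `|` G0) g -> (Y `|` G0) h ->
      (\bigcup_(X in F) X `|` G0) (t *: g + h).
    move=> FX FY Xg Yh.
    have [XY|YX] := Ftot _ _ FX FY.
      have Yg : (Y `|` G0) g by case: Xg => [/XY|]; [left|right].
      by have [Z|Z] := (FP _ FY).1 t _ _ Yg Yh; [left; exists Y|right].
    have Xh : (X `|` G0) h by case: Yh => [/YX|]; [left|right].
    by have [Z|Z] := (FP _ FX).1 t _ _ Xg Xh; [left; exists X|right].
  move=> t g h [[X FX Xg]|Gg] [[Y FY Yh]|Gh].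
  - by apply: (join X Y) => //; left.
  - by apply: (join X X) => //; [left|right].
  - by apply: (join Y Y) => //; [right|left].
  - by right; exact: domG0.1.
set M := A `|` G0 in domA.
have M0 : M 0 by right.
have Mtotal w : exists t : R, M (w, t).
  have [c domc] := dominated_graph_extension w domA M0.
  exists c; apply: contrapT => Mwc.
  set B := [set g | _] in domc.
  have MB : M `<=` B.
    by move=> g Mg; exists g => //; exists 0; rewrite scale0r addr0.
  have Bwc : B (w, c) by exists 0 => //; exists 1; rewrite scale1r add0r.
  apply: (Amax B) => /=.
    split; first by move=> g Ag; apply: MB; left.
    by move=> /(_ _ Bwc) Awc; apply: Mwc; left.
  suff -> : B `|` G0 = B by [].
  by apply/setUidPl => g Gg; apply: MB; right.
have [g Mg] := choice Mtotal.
have Mfun v s t : M (v, s) -> M (v, t) -> s <= t.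
  move=> Ms Mt; rewrite leNgt; apply/negP => ts.
  have : -1 * t + s <= p (-1 *: v + v) := domA.2 _ (domA.1 (-1) _ _ Mt Ms).
  rewrite scaleN1r addNr p0; lra.
have Mg_eq v s : M (v, s) -> g v = s.
  by move=> Ms; apply/eqP; rewrite eq_le (Mfun _ _ _ (Mg v) Ms) (Mfun _ _ _ Ms).
exists g; split.
- by move=> t u v; apply: Mg_eq; exact: domA.1 (Mg u) (Mg v).
- by move=> v; exact: domA.2 _ (Mg v).
- by apply: Mg_eq; right; exists 1 => //; rewrite scale1r.
Qed.
End HahnBanach.

(** * Norms with real values, bounded functionals *)

Section RealNorm.
Context {R : realType} {k : scalar_kind}.
Local Notation K := (scalars R k).

Definition embed : R -> K :=
  match k return R -> scalars R k with
  | RealScalars => id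
  | ComplexScalars => real_complex R
  end.

Lemma embedK : cancel embed (@real_part R k).
Proof. by rewrite /embed /real_part; case: k. Qed.

Lemma embedD s t : embed (s + t) = embed s + embed t.
Proof. by rewrite /embed; case: k => //=; exact: rmorphD. Qed.

Lemma embedM s t : embed (s * t) = embed s * embed t.
Proof. by rewrite /embed; case: k => //=; exact: rmorphM. Qed.

Lemma embed0 : embed 0 = 0.
Proof. by rewrite /embed; case: k. Qed.

Lemma embedN t : embed (- t) = - embed t.
Proof. by apply/eqP; rewrite -addr_eq0 -embedD addNr embed0. Qed.

Lemma embed1 : embed 1 = 1.
Proof. by rewrite /embed; case: k. Qed.

Lemma embed_le s t : (embed s <= embed t) = (s <= t).
Proof. by rewrite /embed; case: k => //=; exact: lecR. Qed.

Lemma embed_lt s t : (embed s < embed t) = (s < t).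
Proof. by rewrite /embed; case: k => //=; exact: ltcR. Qed.

Lemma real_part_ge0K (c : K) : 0 <= c -> embed (real_part c) = c.
Proof.
rewrite /embed /real_part; case: k c => //= c c0.
by apply: RRe_real; exact: ger0_real.
Qed.

Section NormedModule.
Variable V : normedModType K.
Implicit Types u v : V.

Lemma embed_rnorm v : embed (rnorm v) = `|v|.
Proof. exact: real_part_ge0K. Qed.

Lemma rnorm_ge0 v : 0 <= rnorm v.
Proof. by rewrite -embed_le embed0 embed_rnorm. Qed.

Lemma rnorm0 : rnorm (0 : V) = 0.
Proof. by rewrite /rnorm normr0 -embed0 embedK. Qed.

Lemma rnorm_eq0 v : rnorm v = 0 -> v = 0.
Proof. by move=> v0; apply: normr0_eq0; rewrite -embed_rnorm v0 embed0. Qed.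

Lemma rnormN v : rnorm (- v) = rnorm v.
Proof. by rewrite /rnorm normrN. Qed.

Lemma rdistC u v : rnorm (u - v) = rnorm (v - u).
Proof. by rewrite /rnorm distrC. Qed.

Lemma rnormD u v : rnorm (u + v) <= rnorm u + rnorm v.
Proof. by rewrite -embed_le embedD !embed_rnorm ler_normD. Qed.

Lemma rnormB u v : rnorm (u - v) <= rnorm u + rnorm v.
Proof. by rewrite -(rnormN v) rnormD. Qed.

Lemma rnormZ (c : K) v : rnorm (c *: v) = sabs c * rnorm v.
Proof.
apply: (can_inj embedK); rewrite embedM !embed_rnorm normrZ.
by rewrite /sabs real_part_ge0K.
Qed.

Lemma rnorm_sum (I : Type) (s : seq I) (F : I -> V) :
  rnorm (\sum_(i <- s) F i) <= \sum_(i <- s) rnorm (F i).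
Proof.
elim/big_ind2 : _ => [|u a v b ua vb|//]; first by rewrite rnorm0.
exact: le_trans (rnormD _ _) (lerD ua vb).
Qed.

Lemma cvg_rnormP (u : nat -> V) (l : V) : u @ \oo --> l <->
  (forall e : R, 0 < e ->
    exists N, forall n, (N <= n)%N -> rnorm (l - u n) < e).
Proof.
split=> [/cvgrPdist_lt ul e e0|ul].
  have /ul[N _ Nu] : 0 < embed e by rewrite -embed0 embed_lt.
  by exists N => n /Nu; rewrite /= -embed_rnorm embed_lt.
apply/cvgrPdist_lt => e e0.
have ee := real_part_ge0K (ltW e0).
have [|N Nu] := ul (real_part e); first by rewrite -embed_lt ee embed0.
by exists N => // n /Nu; rewrite -embed_lt embed_rnorm ee.
Qed.

End NormedModule.

Lemma cauchy_rnorm_cvg (V : completeNormedModType K) (u : nat -> V) :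
  (forall e : R, 0 < e -> exists N, forall m n, (N <= m)%N -> (N <= n)%N ->
    rnorm (u m - u n) < e) -> cvg (u @ \oo).
Proof.
move=> cu; apply/cauchy_cvgP/cauchy_ballP => e e0; near_simpl.
have ee := real_part_ge0K (ltW e0).
have [|N Nu] := cu (real_part e); first by rewrite -embed_lt ee embed0.
exists ([set n | (N <= n)%N], [set n | (N <= n)%N]); first by split; exists N.
move=> [m n] [/= Nm Nn]; rewrite -ball_normE /=.
by rewrite -embed_rnorm -ee embed_lt Nu.
Qed.

Lemma sabs_rnorm (c : K) : sabs c = rnorm (c : K^o).
Proof. by []. Qed.

Lemma sabsM (c d : K) : sabs (c * d) = sabs c * sabs d.
Proof. exact: (rnormZ c (d : K^o)). Qed.

Lemma sabs_embed t : sabs (embed t) = `|t|.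
Proof.
have [t0|t0] := leP 0 t.
  by rewrite /sabs !ger0_norm// -?embed0 ?embed_le// embedK.
rewrite sabs_rnorm -rnormN -embedN.
by rewrite /rnorm ger0_norm ?embedK ?ltr0_norm// -embed0 embed_le oppr_ge0 ltW.
Qed.

Lemma bounded_continuous (V W : normedModType K) (f : {linear V -> W}) (C : R) :
  (forall v, rnorm (f v) <= C * rnorm v) -> continuous f.
Proof.
move=> fC v; apply/cvgrPdist_lt => e e0.
have ee := real_part_ge0K (ltW e0).
have re0 : 0 < real_part e by rewrite -embed_lt ee embed0.
have C1 : 0 < `|C| + 1 by rewrite ltr_wpDl.
near=> u; rewrite -raddfB -embed_rnorm -ee embed_lt.
have : rnorm (v - u) < real_part e / (`|C| + 1).
  rewrite -embed_lt embed_rnorm; near: u.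
  have /cvgrPdist_lt : u @[u --> v] --> v by exact: cvg_id.
  by apply; rewrite -embed0 embed_lt divr_gt0.
rewrite ltr_pdivlMr// => h.
apply: le_lt_trans (fC _) _; apply: le_lt_trans h.
by rewrite mulrC ler_wpM2l ?rnorm_ge0// (le_trans (ler_norm C))// lerDl.
Unshelve. all: by end_near. Qed.

Lemma continuous_bounded (V W : normedModType K) (f : {linear V -> W}) :
  continuous f -> exists2 C : R, 0 <= C & forall v, rnorm (f v) <= C * rnorm v.
Proof.
move=> /(_ 0) /cvgrPdist_lt /(_ 1 ltr01).
rewrite raddf0 => /nbhs_norm0P [d /= d0 fd].
have dd := real_part_ge0K (ltW d0); set r := real_part d in dd.
have r0 : 0 < r by rewrite -embed_lt dd embed0.
exists (2 / r); first by rewrite divr_ge0 ?ltW.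
move=> v; have [v0|v0] := leP (rnorm v) 0.
  have -> : v = 0 by apply: rnorm_eq0; apply/eqP; rewrite eq_le v0 rnorm_ge0.
  by rewrite raddf0 !rnorm0 mulr0.
(* this factor scales [v] to the norm [r / 2] *)
pose t := r / (2 * rnorm v).
have t0 : 0 < t by rewrite divr_gt0 ?mulr_gt0.
have := fd (embed t *: v) => /=.
rewrite sub0r normrN linearZ -!embed_rnorm !rnormZ sabs_embed gtr0_norm//.
rewrite -dd -embed1 !embed_lt => h.
have /h : t * rnorm v < r.
  rewrite /t invfM mulrA -mulrA mulVf ?gt_eqF// mulr1; lra.
rewrite mulrC -ltr_pdivlMr// /t invf_div mul1r => /ltW; congr (_ <= _).
by rewrite mulrAC.
Qed.

Lemma real_part_le_sabs (c : K) : real_part c <= sabs c.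
Proof.
rewrite /sabs /real_part; case: k c => /= c; first exact: ler_norm.
have := normc_ge_Re c; rewrite normc_def lecR /=.
by case: c => x y /=; apply: le_trans; exact: ler_norm.
Qed.

End RealNorm.
Arguments embed {R k}.

Section Dual.
Context {R : realType} {k : scalar_kind}.
Context {E : completeNormedModType (scalars R k)}.
Implicit Type f : dual E.

Lemma dual_norm_ub f v : rnorm v <= 1 -> sabs (f v) <= dual_norm f.
Proof.
move=> v1; have [C C0 fC] := continuous_bounded (@dual_continuous _ _ _ f).
apply: sup_upper_bound; last by exists v.
split; first by exists (sabs (f v)), v.
by exists C => _ [u /= u1 <-]; apply: le_trans (fC u) _; rewrite ler_piMr.
Qed.

Lemma dual_norm_ge0 f : 0 <= dual_norm f.
Proof.
apply: le_trans (dual_norm_ub f (v := 0) _); last by rewrite rnorm0.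
by rewrite sabs_rnorm rnorm_ge0.
Qed.

Lemma sabs_dual_le f v : sabs (f v) <= dual_norm f * rnorm v.
Proof.
have [v0|v0] := leP (rnorm v) 0.
  have -> : v = 0 by apply: rnorm_eq0; apply/eqP; rewrite eq_le v0 rnorm_ge0.
  by rewrite raddf0 sabs_rnorm !rnorm0 mulr0.
rewrite -ler_pdivrMr//.
have := @dual_norm_ub f (embed (rnorm v)^-1 *: v).
have sv : sabs (embed (k := k) (rnorm v)^-1) = (rnorm v)^-1.
  by rewrite sabs_embed gtr0_norm ?invr_gt0.
rewrite linearZ [sabs (_ *: _)]sabs_rnorm !rnormZ sv mulVf ?gt_eqF// mulrC.
exact.
Qed.

Lemma dual_norm_le f M :
  (forall v, sabs (f v) <= M * rnorm v) -> 0 <= M -> dual_norm f <= M.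
Proof.
move=> fM M0; apply: sup_le_ub.
  by exists (sabs (f 0)), 0 => //=; rewrite rnorm0.
by move=> _ [v /= v1 <-]; apply: le_trans (fM v) _; rewrite ler_piMr.
Qed.

(** A copy of [E] that carries the structure of a real vector space, even when
    the scalars of [E] are complex, so that the real Hahn-Banach theorem
    applies to it. *)
Definition realified : Type := E.
HB.instance Definition _ := GRing.Zmodule.on realified.
Let rscale (t : R) (v : realified) : realified := embed (k := k) t *: (v : E).
Let rscaleA s t v : rscale s (rscale t v) = rscale (s * t) v.
Proof. by rewrite /rscale scalerA embedM. Qed.
Let rscale1 : left_id 1 rscale.
Proof. by move=> v; rewrite /rscale embed1 scale1r. Qed.
Let rscaleDr : right_distributive rscale +%R.
Proof. by move=> t u v; exact: scalerDr. Qed.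
Let rscaleDl v : {morph rscale^~ v : s t / s + t}.
Proof. by move=> s t; rewrite /rscale embedD; exact: scalerDl. Qed.
HB.instance Definition _ := GRing.Zmodule_isLmodule.Build R realified
  rscaleA rscale1 rscaleDr rscaleDl.

Lemma real_norming_functional (v0 : E) : exists g : E -> R,
  [/\ forall t u v, g (embed t *: u + v) = t * g u + g v,
      forall v, g v <= rnorm v & g v0 = rnorm v0].
Proof.
have sub (u v : realified) : rnorm (u + v : E) <= rnorm (u : E) + rnorm (v : E).
  exact: rnormD.
have hom t (v : realified) : 0 <= t -> rnorm (t *: v : E) = t * rnorm (v : E).
  by move=> t0; rewrite [LHS]rnormZ sabs_embed ger0_norm.
exact: (hahn_banach_norming sub hom v0).
Qed.

End Dual.

Lemma bounded_linear_dual (R : realType) (k : scalar_kind)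
    (E : completeNormedModType (scalars R k)) (f : E -> (scalars R k)^o)
    (C : R) :
  linear f -> (forall v, sabs (f v) <= C * rnorm v) ->
  exists g : dual E, forall v, g v = f v.
Proof.
move=> flin fC.
pose F : {linear E -> (scalars R k)^o} :=
  HB.pack f (GRing.isLinear.Build (scalars R k) E (scalars R k)^o *:%R f flin).
by exists (Dual (bounded_continuous (f := F) fC)).
Qed.

Section ComplexFunctional.
Context {R : realType} {E : completeNormedModType (scalars R ComplexScalars)}.
Local Notation C := (scalars R ComplexScalars).
Let I : C := ('i%C : complex R).
Variable g : E -> R.
Hypothesis g_linear : forall t u v, g (embed t *: u + v) = t * g u + g v.

(** A complex-linear functional is determined by its real part [g]: its value
    at [v] is [g v - 'i * g ('i *: v)]. *)
Definition complexification (v : E) : C := embed (g v) - I * embed (g (I *: v)).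

Lemma real_part_complexification v : real_part (complexification v) = g v.
Proof.
rewrite /complexification /real_part /embed /= mul0r mul1r [X in _ - X]subrr.
exact: subr0.
Qed.

Lemma complexification_linear : linear (complexification : E -> C^o).
Proof.
have I2 : I * I = -1 by rewrite -expr2; exact: sqr_i.
have g0 : g 0 = 0.
  by have := g_linear 1 0 0; rewrite scaler0 addr0 mul1r => h; lra.
have gD u v : g (u + v) = g u + g v.
  by have := g_linear 1 u v; rewrite embed1 scale1r mul1r.
have gZ t u : g (embed t *: u) = t * g u.
  by have := g_linear t u 0; rewrite g0 !addr0.
have fD u v :
    complexification (u + v) = complexification u + complexification v.
  by rewrite /complexification scalerDr !gD !embedD mulrDr opprD addrACA.
have fZ t u : complexification (embed t *: u) = embed t * complexification u.
  rewrite /complexification scalerA [I * embed t]mulrC -scalerA !gZ !embedM.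
  by rewrite mulrBr [I * (_ * _)]mulrCA.
have fI u : complexification (I *: u) = I * complexification u.
  rewrite /complexification scalerA I2 mulrBr mulrA I2.
  have -> : -1 *: u = embed (-1) *: u by rewrite embedN embed1.
  rewrite gZ mulN1r (mulN1r (embed _)) embedN mulrN !opprK addrC //.
move=> c u v; rewrite fD; congr (_ + _).
have -> : c = embed (complex.Re c) + I * embed (complex.Im c).
  exact: complexE.
by rewrite scalerDl fD -scalerA fI !fZ mulrA -mulrDl.
Qed.

(** Multiplying [v] by the scalar [theta] of modulus one that makes the value
    at [theta *: v] equal to the modulus of the value at [v] reduces the bound
    to that of the real part. *)
Lemma complexification_le v :
  (forall u, g u <= rnorm u) -> sabs (complexification v) <= rnorm v.
Proof.
move=> gle; set c := complexification v.
have [c0|c0] := eqVneq c 0; first by rewrite c0 sabs_rnorm rnorm0 rnorm_ge0.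
have cc : (sabs c : R) != 0.
  by apply: contra c0 => /eqP h; apply/eqP; exact: (@rnorm_eq0 _ _ C^o).
have fr : complexification ((embed (sabs c) / c) *: v) = embed (sabs c).
  rewrite (GRing.scalable_linear complexification_linear).
  by rewrite -[LHS]/(_ * c) divfK.
have := gle ((embed (sabs c) / c) *: v).
rewrite -real_part_complexification fr embedK rnormZ.
suff -> : sabs (embed (sabs c) / c) = 1 by rewrite mul1r.
apply: (mulIf cc); rewrite -sabsM divfK// mul1r sabs_embed ger0_norm//.
exact: (rnorm_ge0 (c : C^o)).
Qed.

End ComplexFunctional.

(** Let [g] be a real functional, dominated by the norm, with value [rnorm v] at
    [v]. It is as required when the scalars are real; otherwise it is the real
    part of the required one, whose value at [v] has a modulus of at least
    [g v] and, by the bound on its norm, at most [rnorm v]. *)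
Theorem norming_functional (R : realType) (k : scalar_kind)
    (E : completeNormedModType (scalars R k)) (v : E) :
  exists2 f : dual E, dual_norm f <= 1 & sabs (f v) = rnorm v.
Proof.
suff [f [flin fle fv]] : exists f : E -> (scalars R k)^o,
    [/\ linear f, forall u, sabs (f u) <= rnorm u & rnorm v <= sabs (f v)].
  have fle1 u : sabs (f u) <= 1 * rnorm u by rewrite mul1r.
  have [F Ff] := bounded_linear_dual flin fle1.
  exists F; first by apply: dual_norm_le => // u; rewrite Ff.
  by apply/eqP; rewrite Ff eq_le fle.
have [g [glin gle gv]] := real_norming_functional v.
case: k E v g glin gle gv => E v g glin gle gv; last first.
  exists (complexification g); split.
  - exact: complexification_linear.
  - by move=> u; exact: complexification_le.
  - by rewrite -gv -real_part_complexification real_part_le_sabs.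
exists g; split=> //; last by rewrite -gv; exact: ler_norm.
move=> u; rewrite /sabs /= ler_norml gle andbT lerNl.
have := glin (-1) u 0; have := glin 1 0 0.
rewrite scaler0 !addr0 mul1r => g0.
rewrite (_ : g 0 = 0); last by lra.
rewrite addr0 mulN1r => <-; apply: le_trans (gle _) _.
by rewrite rnormZ sabs_embed normrN1 mul1r.
Qed.

(** In the complex case the real and the imaginary parts are absolutely
    summable, which reduces the claim to real series. *)
Lemma summable_scalars_cvg (R : realType) (k : scalar_kind)
    (c : nat -> scalars R k) (M : R) :
  (forall n, \sum_(0 <= i < n) sabs (c i) <= M) ->
  cvg (series (c : nat -> (scalars R k)^o) @ \oo).
Proof.
have real_case (d : nat -> R) :
    (forall n, \sum_(0 <= i < n) `|d i| <= M) -> cvg (series d @ \oo).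
  move=> dM; apply: (@normed_cvg _ R^o); apply: nondecreasing_is_cvgn.
    apply/nondecreasing_seqP => n.
    by rewrite /= !seriesEnat/= big_nat_recr//= lerDl.
  by exists M => _ [n _ <-]; rewrite /= seriesEnat; exact: dM.
case: k c => c cM; first exact: real_case.
have reM n : \sum_(0 <= i < n) `|complex.Re (c i)| <= M.
  apply: le_trans (cM n); apply: ler_sum => i _.
  by have := normc_ge_Re (c i); rewrite normc_def lecR; case: (c i).
have imM n : \sum_(0 <= i < n) `|complex.Im (c i)| <= M.
  apply: le_trans (cM n); apply: ler_sum => i _.
  rewrite /sabs /=; case: (c i) => a b /=.
  by rewrite -sqrtr_sqr ler_wsqrtr// lerDr sqr_ge0.
move: (real_case _ reM) (real_case _ imM) => /cvg_ex[a ca] /cvg_ex[b cb].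
apply/cvg_ex; exists ((a +i* b)%C : complex R).
apply/cvg_rnormP => e e0.
have e2 : 0 < e / 2 by rewrite divr_gt0.
have [N1 N1P] := (@cvg_rnormP R RealScalars R^o _ _).1 ca _ e2.
have [N2 N2P] := (@cvg_rnormP R RealScalars R^o _ _).1 cb _ e2.
exists (maxn N1 N2) => n; rewrite geq_max => /andP[/N1P n1 /N2P n2].
rewrite [e]splitr; apply: le_lt_trans (ltrD n1 n2).
have -> : series (c : nat -> (scalars R ComplexScalars)^o) n =
    (series (fun i => complex.Re (c i)) n +i*
     series (fun i => complex.Im (c i)) n)%C.
  rewrite /series /=; elim: n {n1 n2} => [|n IH]; first by rewrite !big_geq.
  by rewrite !big_nat_recr//= IH; case: (c n).
move: (series _ n) (series _ n) {n1 n2} => q p.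
change (Num.sqrt ((a - p) ^+ 2 + (b - q) ^+ 2) <= `|a - p| + `|b - q|).
move: (a - p) (b - q) => {}p {}q.
rewrite -[leRHS]ger0_norm ?addr_ge0// -sqrtr_sqr ler_wsqrtr//.
rewrite sqrrD !real_normK ?num_real// addrAC lerDl mulrn_wge0 ?mulr_ge0//.
Qed.

(** * Weakly unconditionally Cauchy series *)

(** Rosenthal's lemma, by induction on [n]. Split the integers into infinitely
    many infinite parts, the sets of all [pair p q] for [p] fixed. If no part
    has small off-diagonal row sums, every part [p] contains an index [psi p]
    whose row has a sum above [e] over other indices of the same part. These
    indices are not in the range of [psi], so the rows of the matrix restricted
    to the range of [psi] have sums at most [n%:R * e]. *)
Lemma rosenthal (R : realType) (e : R) (n : nat) (r : nat -> nat -> R) :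
  0 <= e ->
  (forall i (l : seq nat), uniq l -> \sum_(j <- l) r i j <= n%:R * e) ->
  exists2 phi : nat -> nat, injective phi &
    forall i (l : seq nat), uniq l -> i \notin l ->
      \sum_(j <- l) r (phi i) (phi j) <= e.
Proof.
move=> e0; elim: n r => [|n IH] r rn.
  by exists id => // i l ul _; apply: le_trans (rn i l ul) _; rewrite mul0r.
pose pair (p q : nat) : nat := pickle (p, q).
have pair_inj p q p' q' : pair p q = pair p' q' -> p = p' /\ q = q'.
  by move=> /(pcan_inj pickleK)[].
have [[p hp]|/forallNP all_bad] := pselect (exists p,
    forall q (l : seq nat), uniq l -> q \notin l ->
    \sum_(q' <- l) r (pair p q) (pair p q') <= e).
  by exists (pair p) => // q q' /pair_inj[].
have {}all_bad p : exists ql : nat * seq nat, [/\ uniq ql.2, ql.1 \notin ql.2 &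
    e < \sum_(q' <- ql.2) r (pair p ql.1) (pair p q')].
  apply: contrapT => none; apply: (all_bad p) => q l ul ql.
  by rewrite leNgt; apply/negP => h; apply: none; exists (q, l).
(* [ql p] collects the bad index of the part [p] and the list that shows it *)
have {all_bad} [ql qlP] := choice all_bad.
pose psi p := pair p (ql p).1.
have psi_inj : injective psi by move=> p p' /pair_inj[].
have [|phi phi_inj phiP] := IH (fun i j => r (psi i) (psi j)).
  move=> p m um; have [ul ql' le] := qlP p.
  have : uniq (map psi m ++ map (pair p) (ql p).2).
    rewrite cat_uniq map_inj_uniq// um map_inj_uniq ?ul ?andbT; last first.
      by move=> q q' /pair_inj[].
    apply/hasPn => _ /mapP[q qin ->].
    apply/negP => /mapP[p' _ /pair_inj[pp qq]].
    by move: ql'; rewrite pp -qq -pp qin.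
  move=> /(rn (psi p)); rewrite big_cat !big_map -natr1 mulrDl mul1r /=.
  by rewrite -/(psi p) in le; lra.
by exists (psi \o phi) => //; exact: inj_comp.
Qed.

(** Cantor's diagonal argument, for the set of the values [h N] at the sets [N]
    that do not contain [h N]. *)
Lemma cantor_collision (h : (nat -> bool) -> nat) :
  exists N N' i, [/\ h N = h N', N i & ~~ N' i].
Proof.
pose B n := `[< exists2 N, h N = n & ~~ N n >].
have [Bn|Bn] := boolP (B (h B)).
  by have [N hN Nn] := asboolP _ Bn; exists B, N, (h B).
by case/negP: (Bn); apply/asboolP; exists B.
Qed.

Section BanachSpace.
Context {R : realType} {k : scalar_kind}.
Context {E : completeNormedModType (scalars R k)}.
Implicit Types (f : dual E) (v : nat -> E).

(** Approximate each [F N] within [d / 2] by a point of a countable dense set;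
    two different [N] get the same point. *)
Lemma separable_collision (F : (nat -> bool) -> E) (d : R) :
  separable E -> 0 < d ->
  exists N N' i, [/\ rnorm (F N - F N') < d, N i & ~~ N' i].
Proof.
move=> [D /countable_injP[g ginj] Ddense] d0.
have d2 : 0 < embed (k := k) (d / 2) by rewrite -embed0 embed_lt divr_gt0.
have close N : exists u, D u /\ rnorm (F N - u) < d / 2.
  have [||u [/interior_subset Fu Du]] := Ddense (ball (F N) (embed (d / 2)))^°.
  - by exists (F N); exact: nbhsx_ballx.
  - exact: open_interior.
  exists u; split=> //; move: Fu; rewrite -ball_normE /=.
  by rewrite -embed_rnorm embed_lt.
have [G GP] := choice close.
have [N [N' [i [h Ni N'i]]]] := cantor_collision (g \o G).
exists N, N', i; split=> //.
have GD M : G M \in D by rewrite inE; have [] := GP M.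
have GG : G N = G N' := ginj _ _ (GD N) (GD N') h.
have -> : F N - F N' = (F N - G N) - (F N' - G N') by rewrite GG opprB subrKA.
apply: le_lt_trans (rnormD _ _) _; rewrite rnormN [d]splitr.
by apply: ltrD; [have [] := GP N | have [] := GP N'].
Qed.

(** Summability is expressed with finite lists of distinct indices, a form that
    is stable under passing to subsequences and grouping into blocks. *)
Definition weakly_unconditionally_cauchy v (C : R) : Prop :=
  forall f (l : seq nat), uniq l ->
    \sum_(j <- l) sabs (f (v j)) <= C * dual_norm f.

Lemma wuc_inj_comp v C (phi : nat -> nat) : injective phi ->
  weakly_unconditionally_cauchy v C ->
  weakly_unconditionally_cauchy (v \o phi) C.
Proof.
move=> phi_inj vC f l ul.
by have := vC f (map phi l); rewrite big_map; apply; rewrite map_inj_uniq.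
Qed.

Hypothesis E_wsc : weakly_sequentially_complete E.

(** A functional maps the partial sums of a subseries to those of an absolutely
    convergent series of scalars; weak sequential completeness then provides the
    weak sum. *)
Lemma wuc_weak_subsums v C : weakly_unconditionally_cauchy v C ->
  exists L : (nat -> bool) -> E, forall N f,
    f (\sum_(0 <= j < n | N j) v j) @[n --> \oo] --> f (L N).
Proof.
move=> vC.
suff /choice[L LP] : forall N : nat -> bool, exists l, forall f,
    f (\sum_(0 <= j < n | N j) v j) @[n --> \oo] --> f l by exists L.
move=> N; apply: E_wsc => f.
have -> : (fun n => f (\sum_(0 <= j < n | N j) v j)) =
    series (fun j => if N j then f (v j) else 0 : (scalars R k)^o).
  by apply/funext => n; rewrite linear_sum /= /series /= big_mkcond.
apply: (@summable_scalars_cvg _ _ _ (C * dual_norm f)) => n.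
apply: le_trans (vC f _ (iota_uniq 0 (n - 0))); apply: ler_sum => j _.
by case: ifP => // _; rewrite !sabs_rnorm rnorm0 rnorm_ge0.
Qed.

Hypothesis E_separable : separable E.

(** Otherwise, after a selection of indices by Rosenthal's lemma, the weak
    sums of any two distinct subseries would be at a distance at least
    [e / 2], which separability excludes. *)
Lemma wuc_not_bounded_below v C (e : R) : 0 < e ->
  weakly_unconditionally_cauchy v C -> exists j, rnorm (v j) < e.
Proof.
move=> e0 vC; apply: contrapT => /forallNP big_v.
have {}big_v j : e <= rnorm (v j) by rewrite leNgt; apply/negP/big_v.
have normers j : exists f, dual_norm f <= 1 /\ sabs (f (v j)) = rnorm (v j).
  by have [f] := norming_functional (v j); exists f.
have {normers}[f fP] := choice normers.
(* since [v 0] is not zero, [C] is not negative *)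
have C0 : 0 <= C.
  have := vC (f 0) [:: 0%N] erefl; rewrite big_seq1; have [+ ->] := fP 0.
  move=> f1 h; have := lt_le_trans e0 (le_trans (big_v 0) h).
  by move=> p; have := dual_norm_ge0 (f 0); move: p; set t := dual_norm _; nra.
(* For distinct [N] and [N'], the value of [f (phi i)] at the difference of the
   weak sums is at least [e - e / 4], up to an error [e / 16] for each limit. *)
have e40 : 0 < e / 4 by rewrite divr_gt0.
have [n Cn] : exists n : nat, C <= n%:R * (e / 4).
  exists (Num.truncn (C / (e / 4))).+1; rewrite -ler_pdivrMr//.
  by rewrite ltW// truncnS_gt.
have [|phi phi_inj phiP] :=
    @rosenthal R (e / 4) n (fun i j => sabs (f i (v j))) (ltW e40).
  move=> i l ul; apply: le_trans (vC _ _ ul) (le_trans _ Cn).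
  by rewrite ler_piMr//; have [] := fP i.
have [L LP] := wuc_weak_subsums (wuc_inj_comp phi_inj vC).
have e20 : 0 < e / 2 by rewrite divr_gt0.
have [N [N' [i [LNN' Ni N'i]]]] := separable_collision L E_separable e20.
pose g := f (phi i); pose u M n := \sum_(0 <= j < n | M j) (v \o phi) j.
have e16 : 0 < e / 16 by rewrite divr_gt0.
have [n1 n1P] := (cvg_rnormP _ _).1 (LP N g) _ e16.
have [n2 n2P] := (cvg_rnormP _ _).1 (LP N' g) _ e16.
pose m := maxn i.+1 (maxn n1 n2).
have /n1P mN : (n1 <= m)%N by rewrite !leq_max leqnn ?orbT.
have /n2P mN' : (n2 <= m)%N by rewrite !leq_max leqnn ?orbT.
have im : (i < m)%N by rewrite !leq_max leqnn ?orbT.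
pose t j := (if N j then v (phi j) else 0) - (if N' j then v (phi j) else 0).
have decomp : u N m - u N' m = v (phi i) + \sum_(j <- rem i (iota 0 m)) t j.
  rewrite /u big_mkcond [in X in _ - X]big_mkcond -sumrB /index_iota subn0.
  by rewrite (big_rem i) ?mem_iota//= Ni (negbTE N'i) subr0.
have off_diagonal : sabs (g (\sum_(j <- rem i (iota 0 m)) t j)) <= e / 4.
  have ur : uniq (rem i (iota 0 m)) by rewrite rem_uniq ?iota_uniq.
  have ir : i \notin rem i (iota 0 m).
    by rewrite mem_rem_uniq ?iota_uniq// inE eqxx.
  apply: le_trans (phiP i _ ur ir); rewrite linear_sum sabs_rnorm.
  apply: le_trans (rnorm_sum _ _) _; apply: ler_sum => j _.
  rewrite -sabs_rnorm /t /g; case: (N j); case: (N' j);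
    rewrite ?subr0 ?subrr ?sub0r ?raddf0 ?raddfN ?sabs_rnorm ?rnormN ?rnorm0//;
    by rewrite ?rnorm_ge0.
have [g1 gv] := fP (phi i); rewrite -/g in g1 gv.
have := big_v (phi i); rewrite -gv.
have -> : v (phi i) = (u N m - L N) + (L N - L N') - (u N' m - L N')
    - \sum_(j <- rem i (iota 0 m)) t j.
  by rewrite addrA subrK opprB addrA subrK decomp addrK.
have near_N : sabs (g (u N m - L N)) < e / 16.
  by rewrite raddfB sabs_rnorm rdistC; exact: mN.
have near_N' : sabs (g (u N' m - L N')) < e / 16.
  by rewrite raddfB sabs_rnorm rdistC; exact: mN'.
have far : sabs (g (L N - L N')) < e / 2.
  apply: le_lt_trans (sabs_dual_le _ _) (le_lt_trans _ LNN').
  by rewrite ler_piMl ?rnorm_ge0.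
have := rnormB (g (u N m - L N) + g (L N - L N') - g (u N' m - L N'))
  (g (\sum_(j <- rem i (iota 0 m)) t j)).
have := rnormB (g (u N m - L N) + g (L N - L N')) (g (u N' m - L N')).
have := rnormD (g (u N m - L N)) (g (L N - L N')).
rewrite -raddfD -!raddfB -!sabs_rnorm; lra.
Qed.

(** A failure of the Cauchy criterion yields blocks of indices with large sums;
    each one is sought after the end [N i] of the previous ones, so they are pairwise
    disjoint. Disjointness is stated as uniqueness of a concatenation, which is
    the form that [weakly_unconditionally_cauchy] accepts. *)
Lemma series_blocks v (e : R) :
  (forall N, exists m n, [/\ (N <= m)%N, (m <= n)%N &
    e <= rnorm (\sum_(m <= j < n) v j)]) ->
  exists B : nat -> seq nat, [/\ forall l, uniq l -> uniq (flatten (map B l)) &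
    forall i, e <= rnorm (\sum_(j <- B i) v j)].
Proof.
move=> blocks.
have {}blocks N : exists mn : nat * nat, [/\ (N <= mn.1)%N, (mn.1 <= mn.2)%N &
    e <= rnorm (\sum_(mn.1 <= j < mn.2) v j)].
  by have [m [n mnP]] := blocks N; exists (m, n).
have [h hP] := choice blocks.
pose N i := iter i (fun n => (h n).2) 0%N.
have Nhomo : {homo N : i j / (i <= j)%N}.
  apply: homo_leq => // [? ? ?|i]; first exact: leq_trans.
  by have [+ + _] := hP (N i); exact: leq_trans.
have B_lt i j n : (i < j)%N -> n \in index_iota (h (N i)).1 (h (N i)).2 ->
    n \in index_iota (h (N j)).1 (h (N j)).2 -> False.
  move=> /Nhomo ij; rewrite !mem_index_iota => /andP[_ ni] /andP[nj _].
  have [Nj _ _] := hP (N j).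
  by have := leq_trans ni (leq_trans ij (leq_trans Nj nj)); rewrite ltnn.
exists (fun i => index_iota (h (N i)).1 (h (N i)).2); split; last first.
  by move=> i; have [] := hP (N i).
elim=> // i l IH /= /andP[il ul]; rewrite cat_uniq iota_uniq IH// andbT /=.
apply/hasPn => n /flatten_mapP[j jl nj]; apply/negP => ni.
have [ij|ji|ij] := ltngtP i j; first exact: (B_lt _ _ _ ij ni nj).
- exact: (B_lt _ _ _ ji nj ni).
- by rewrite ij jl in il.
Qed.

(** The Bessaga-Pelczynski theorem: block sums of a weakly unconditionally
    Cauchy series again form such a series, so they cannot stay away from
    zero. *)
Theorem wuc_series_cvg v C :
  weakly_unconditionally_cauchy v C -> cvg (series v @ \oo).
Proof.
move=> vC; apply: cauchy_rnorm_cvg => e e0.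
apply: contrapT => /forallNP not_cauchy.
have [N|B [Buniq Bbig]] := @series_blocks v e.
  apply: contrapT => small; apply: (not_cauchy N).
  suff le m n : (N <= m)%N -> (m <= n)%N -> rnorm (series v n - series v m) < e.
    move=> m n Nm Nn; have [mn|/ltnW nm] := leqP m n; last exact: le.
    by rewrite rdistC; exact: le.
  move=> Nm mn; rewrite sub_series_geq//.
  by rewrite ltNge; apply/negP => h; apply: small; exists m, n.
have [|i] := @wuc_not_bounded_below (fun i => \sum_(j <- B i) v j) C e e0;
  last first.
  by rewrite ltNge Bbig.
move=> f l ul; apply: le_trans (vC f _ (Buniq _ ul)).
rewrite big_flatten big_map; apply: ler_sum => j _.
by rewrite linear_sum sabs_rnorm; exact: rnorm_sum.
Qed.

End BanachSpace.

(** * Series of nonnegative terms *)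

Section NonnegativeSeries.
Context {R : realType} (c : nat -> R).
Hypothesis c_ge0 : forall n, 0 <= c n.

Lemma nneseries_le_partial_sums M : (forall n, \sum_(0 <= i < n) c i <= M) ->
  (\sum_(0 <= n <oo) (c n)%:E <= M%:E)%E.
Proof.
move=> cM; apply: lime_le.
  by apply: is_cvg_nneseries => n _ _; rewrite lee_fin.
by apply: nearW => n; rewrite sumEFin lee_fin.
Qed.

Lemma sum_uniq_le_nneseries M l : (\sum_(0 <= n <oo) (c n)%:E <= M%:E)%E ->
  uniq l -> \sum_(i <- l) c i <= M.
Proof.
move=> cM ul; pose N := (\max_(i <- l) i).+1.
apply: le_trans (_ : \sum_(0 <= i < N) c i <= _); last first.
  rewrite -lee_fin -sumEFin; apply: le_trans cM.
  by apply: nneseries_lim_ge => n _ _; rewrite lee_fin.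
rewrite /index_iota subn0 [leRHS](bigID (mem l)) /= -[leLHS]addr0.
apply: lerD; last exact: sumr_ge0.
rewrite -[leRHS]big_filter (perm_big [seq i <- iota 0 N | i \in l])//.
apply: uniq_perm => //.
  by rewrite filter_uniq ?iota_uniq.
move=> i; rewrite mem_filter mem_iota /= add0n ltnS.
by apply/idP/andP => [il|[]//]; split=> //; exact: leq_bigmax_seq.
Qed.

End NonnegativeSeries.

(** * Operators close to the identity *)

Section NearIdentity.
Context {R : realType} {k : scalar_kind}.
Context {E : completeNormedModType (scalars R k)}.
Variables (T : {linear E -> E}) (alpha : R).
Hypothesis alpha_lt1 : alpha < 1.
Hypothesis T_near_id : forall u, rnorm (T u - u) <= alpha * rnorm u.

Lemma near_id_continuous : continuous T.
Proof.
apply: (bounded_continuous (C := alpha + 1)) => u.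
rewrite -[T u](subrK u) mulrDl mul1r.
by apply: le_trans (rnormD _ _) _; rewrite lerD2r.
Qed.

Lemma near_id_bounded_below u : rnorm u <= (1 - alpha)^-1 * rnorm (T u).
Proof.
have a1 : 0 < 1 - alpha by rewrite subr_gt0.
rewrite ler_pdivlMl// mulrBl mul1r lerBlDr.
have := rnormB (T u) (T u - u); rewrite opprB addrC subrK.
by move=> /le_trans; apply; rewrite lerD2l.
Qed.

(** The iteration [u + (v - T u)] multiplies the residual [v - T u] by the
    operator [id - T], of norm at most [alpha], so the residuals tend to zero.
    The iterates are Cauchy because their images are and [T] is bounded
    below. *)
Lemma near_id_surjective : 0 <= alpha -> forall v, exists u, T u = v.
Proof.
move=> alpha_ge0 v; pose u n := iter n (fun u => u + (v - T u)) 0.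
have residual n : rnorm (v - T (u n)) <= alpha ^+ n * rnorm v.
  elim: n => [|n IH]; first by rewrite raddf0 subr0 mul1r.
  have -> : v - T (u n.+1) = - (T (v - T (u n)) - (v - T (u n))).
    by rewrite /= raddfD opprD addrA opprB.
  rewrite rnormN exprS -mulrA.
  by apply: le_trans (T_near_id _) _; rewrite ler_wpM2l.
have residual0 : (fun n => v - T (u n)) @ \oo --> (0 : E).
  apply/cvg_rnormP => e e0.
  have : (fun n => alpha ^+ n * rnorm v) @ \oo --> (0 : R).
    rewrite -(mul0r (rnorm v)); apply: cvgMl; apply: cvg_expr.
    by rewrite ger0_norm.
  move=> /(@cvg_rnormP R RealScalars R^o) /(_ e e0)[N NP].
  exists N => n /NP; rewrite !sub0r !rnormN; apply: le_lt_trans.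
  by apply: le_trans (residual n) _; exact: ler_norm.
have /cvg_ex[/= l ul] : cvg (u @ \oo).
  apply: cauchy_rnorm_cvg => e e0.
  have a1 : 0 < 1 - alpha by rewrite subr_gt0.
  have [|N NP] := (cvg_rnormP _ _).1 residual0 ((1 - alpha) * (e / 2)).
    by rewrite mulr_gt0// divr_gt0.
  exists N => m n /NP + /NP; rewrite !sub0r !rnormN => hm hn.
  apply: le_lt_trans (near_id_bounded_below _) _; rewrite ltr_pdivrMl// raddfB.
  have -> : T (u m) - T (u n) = (v - T (u n)) - (v - T (u m)).
    by rewrite opprB [RHS]addrC subrKA.
  by apply: le_lt_trans (rnormB _ _) _; lra.
exists l.
have Tul : T (u n) @[n --> \oo] --> T l.
  by apply: continuous_cvg ul; exact: near_id_continuous.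
have Tv : v - T (u n) + T (u n) @[n --> \oo] --> 0 + T l by exact: cvgD.
rewrite (_ : (fun n => _) = fun=> v) in Tv; last first.
  by apply/funext => n; exact: subrK.
rewrite add0r in Tv.
exact: (cvg_unique (@norm_hausdorff _ _) Tv (cvg_cst v)).
Qed.

Lemma near_id_inverse : 0 <= alpha -> exists S : {linear E -> E},
  [/\ cancel T S, cancel S T &
      forall u, rnorm (S u) <= (1 - alpha)^-1 * rnorm u].
Proof.
move=> /near_id_surjective/choice[S TS].
have ST : cancel T S.
  move=> u; apply/eqP; rewrite -subr_eq0; apply/eqP/rnorm_eq0/eqP.
  rewrite eq_le rnorm_ge0 andbT.
  apply: le_trans (near_id_bounded_below _) _.
  by rewrite linearB TS subrr rnorm0 mulr0.
have Slin : linear S by move=> c u v; rewrite -[RHS]ST linearP !TS.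
exists (HB.pack_for {linear E -> E} S (GRing.isLinear.Build _ E E *:%R S Slin)).
split=> // u; rewrite -[in leRHS](TS u); exact: near_id_bounded_below.
Qed.

End NearIdentity.

(** * Perturbation of frames *)

Section PerturbedFrame.
Context {R : realType} {k : scalar_kind}.
Context {E : completeNormedModType (scalars R k)}.
Local Notation K := (scalars R k).
Implicit Types (f g : dual E) (a w x : nat -> E) (b y z : nat -> dual E).

Definition frame_series x y (u : E) : nat -> E :=
  series (fun n => (y n u : K) *: x n).

Definition bessel_bound x y (M : R) : Prop := forall u f n,
  \sum_(0 <= i < n) sabs (y i u) * sabs (f (x i)) <= M * rnorm u * dual_norm f.

Lemma dualZ f (t : K) v : f (t *: v) = t * f v.
Proof. exact: linearZ. Qed.

Lemma dual_perturbation f a b x y n u :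
  f ((y n u : K) *: x n - (b n u : K) *: a n) =
  y n u * f (x n - a n) + (y n u - b n u) * f (a n).
Proof. by rewrite !linearB !dualZ mulrBr mulrBl addrA subrK. Qed.

Section Operator.
Hypothesis E_separable : separable E.
Hypothesis E_wsc : weakly_sequentially_complete E.
Variables (a x : nat -> E) (b y : nat -> dual E) (alpha : R).
Hypothesis alpha_ge0 : 0 <= alpha.
Hypothesis perturbation : forall u f,
  (\sum_(0 <= n <oo)
     (sabs (y n u * f (x n - a n) + (y n u - b n u) * f (a n)))%:E
   <= (alpha * rnorm u * dual_norm f)%:E)%E.

Let difference u n : E := (y n u : K) *: x n - (b n u : K) *: a n.

Let difference_wuc u :
  weakly_unconditionally_cauchy (difference u) (alpha * rnorm u).
Proof.
move=> f l ul; under eq_bigr do rewrite dual_perturbation.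
apply: sum_uniq_le_nneseries ul => [n|]; last exact: perturbation.
by rewrite sabs_rnorm rnorm_ge0.
Qed.

(** The perturbed series differs from the convergent frame expansion of [u] by
    a weakly unconditionally Cauchy series, hence converges. Its sum is within
    [alpha * rnorm u] of [u]: a norming functional [f] of the difference turns
    the hypothesis on scalar series into a bound in norm. *)
Lemma perturbed_frame_operator : schauder_frame a b ->
  exists2 T : {linear E -> E}, forall u, frame_series x y u @ \oo --> T u &
    forall u, rnorm (T u - u) <= alpha * rnorm u.
Proof.
move=> ab_cvg.
have sum_ex u : exists t,
    frame_series x y u @ \oo --> t /\ rnorm (t - u) <= alpha * rnorm u.
  have /cvg_ex[/= D dD] := wuc_series_cvg E_wsc E_separable (difference_wuc u).
  exists (D + u); split.
    have -> : frame_series x y u =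
        series (difference u) \+ series (fun n => (b n u : K) *: a n).
      apply/funext => n; rewrite /frame_series /series /= -big_split /=.
      by apply: eq_bigr => j _; rewrite subrK.
    by apply: cvgD => //; exact: ab_cvg.
  rewrite addrK; have [f f1 <-] := norming_functional D.
  apply/ler_addgt0Pr => e e0.
  have [N /(_ N (leqnn N)) DN] := (cvg_rnormP _ _).1 dD e e0.
  rewrite -[D](subrK (series (difference u) N)) linearD addrC.
  apply: le_trans (rnormD _ _) (lerD _ _).
    rewrite [f (series _ _)]linear_sum; apply: le_trans (rnorm_sum _ _) _.
    apply: le_trans (difference_wuc u f (iota_uniq _ _)) _.
    by rewrite ler_piMr// mulr_ge0// rnorm_ge0.
  apply: le_trans (sabs_dual_le _ _) (le_trans _ (ltW DN)).
  by rewrite ler_piMl// rnorm_ge0.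
have [T TP] := choice sum_ex.
have T_linear : linear T.
  move=> c u v; apply: (cvg_unique (@norm_hausdorff _ _) (TP _).1).
  have -> : frame_series x y (c *: u + v) =
      (fun n => c *: frame_series x y u n) \+ frame_series x y v.
    apply/funext => n.
    rewrite /frame_series /series /= scaler_sumr -big_split /=.
    by apply: eq_bigr => j _; rewrite scalerA -scalerDl linearP.
  by apply: cvgD (TP v).1; apply: cvgZr; exact: (TP u).1.
exists (HB.pack_for {linear E -> E} T
  (GRing.isLinear.Build _ E E *:%R T T_linear)) => u.
- exact: (TP u).1.
- exact: (TP u).2.
Qed.

(** Compare [y i u * f (x i)] with [b i u * f (a i)] term by term. *)
Lemma perturbed_bessel_bound (A : R) :
  (forall u f, (\sum_(0 <= n <oo) (sabs (b n u) * sabs (f (a n)))%:E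
      <= (A * rnorm u * dual_norm f)%:E)%E) ->
  bessel_bound x y (A + alpha).
Proof.
move=> ab_bessel u f n.
have sum_ab : \sum_(0 <= i < n) sabs (b i u) * sabs (f (a i)) <=
    A * rnorm u * dual_norm f.
  apply: sum_uniq_le_nneseries (ab_bessel u f) (iota_uniq _ _) => i.
  by rewrite mulr_ge0// sabs_rnorm rnorm_ge0.
have sum_difference := difference_wuc u f (iota_uniq 0 (n - 0)).
rewrite !mulrDl; apply: le_trans (lerD sum_ab sum_difference).
rewrite -big_split /=; apply: ler_sum => i _; rewrite -!sabsM.
have -> : y i u * f (x i) = b i u * f (a i) + f (difference u i).
  by rewrite linearB !dualZ addrC subrK.
exact: rnormD.
Qed.

End Operator.

(** If the series of the [y n u *: x n] has the sum [T u], the inverse [S] of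
    [T] can be put either on the side of the functionals or on that of the
    vectors. *)
Section Correction.
Variables (x : nat -> E) (y : nat -> dual E) (T S : {linear E -> E}).
Variables (M c : R).
Hypothesis frame_cvg : forall u, frame_series x y u @ \oo --> T u.
Hypothesis xy_bessel : bessel_bound x y M.
Hypotheses (M_gt0 : 0 < M) (c_gt0 : 0 < c).
Hypothesis S_bound : forall u, rnorm (S u) <= c * rnorm u.

Let terms_ge0 u f n w z : 0 <= sabs (z n u) * sabs (f (w n)).
Proof. by rewrite mulr_ge0// sabs_rnorm rnorm_ge0. Qed.

Lemma correct_functionals z : cancel S T ->
  (forall n u, z n u = y n (S u)) -> besselian_schauder_frame x z.
Proof.
move=> ST zE; split=> [u|].
  have -> : (fun n => (z n u : K) *: x n) = fun n => (y n (S u) : K) *: x n.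
    by apply/funext => n; rewrite zE.
  by rewrite -[X in _ --> X]ST; exact: frame_cvg.
exists (M * c) => [|u f]; first exact: mulr_gt0.
apply: nneseries_le_partial_sums => n; first exact: terms_ge0.
under eq_bigr do rewrite zE.
apply: le_trans (xy_bessel _ _ _) _.
by rewrite ler_wpM2r ?dual_norm_ge0// -[leRHS]mulrA ler_wpM2l// ltW.
Qed.

(** The adjoint of [S] is bounded; it carries the Bessel bound over to the
    vectors [S (x n)]. *)
Lemma dual_comp_bounded f : exists2 g : dual E,
  forall u, g u = f (S u) & dual_norm g <= c * dual_norm f.
Proof.
have fS u : sabs (f (S u)) <= c * dual_norm f * rnorm u.
  apply: le_trans (sabs_dual_le _ _) _.
  by rewrite [c * _]mulrC -mulrA ler_wpM2l ?dual_norm_ge0.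
have [g gE] := @bounded_linear_dual _ _ _ (f \o S) _ (linearP _) fS.
exists g => //; apply: dual_norm_le => [u|]; first by rewrite gE; exact: fS.
by rewrite mulr_ge0 ?dual_norm_ge0// ltW.
Qed.

Lemma correct_vectors w : cancel T S ->
  (forall n, w n = S (x n)) -> besselian_schauder_frame w y.
Proof.
move=> TS wE; split=> [u|].
  have -> : series (fun n => (y n u : K) *: w n) = S \o frame_series x y u.
    apply/funext => n; rewrite /frame_series /series /= linear_sum.
    by apply: eq_bigr => j _; rewrite linearZ wE.
  rewrite -[X in _ --> X]TS; apply: continuous_cvg; last exact: frame_cvg.
  by move: (T u); exact: bounded_continuous S_bound.
exists (M * c) => [|u f]; first exact: mulr_gt0.
apply: nneseries_le_partial_sums => n; first exact: terms_ge0.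
have [g gE g_le] := dual_comp_bounded f.
under eq_bigr do rewrite wE -gE.
apply: le_trans (xy_bessel _ _ _) _; have M_ge0 := ltW M_gt0.
by rewrite -!mulrA ler_wpM2l// mulrCA ler_wpM2l ?rnorm_ge0.
Qed.

End Correction.
End PerturbedFrame.

Theorem theorem2 (R : realType) (k : scalar_kind)
  (E : completeNormedModType (scalars R k))
  (E_separable : separable E)
  (E_wsc : weakly_sequentially_complete E)
  (a : nat -> E) (b : nat -> dual E)
  (ab_frame : besselian_schauder_frame a b)
  (x : nat -> E) (y : nat -> dual E)
  (alpha : R) (alpha_ge0 : 0 <= alpha) (alpha_lt1 : alpha < 1)
  (perturbation : forall (u : E) (f : dual E),
    (\sum_(0 <= n <oo)
       (sabs (y n u * f (x n - a n) + (y n u - b n u) * f (a n)))%:E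
     <= (alpha * rnorm u * dual_norm f)%:E)%E) :
  exists (z : nat -> dual E) (w : nat -> E),
    [/\ seq_equiv w x,
        dual_seq_equiv z y,
        besselian_schauder_frame x z &
        besselian_schauder_frame w y].
Proof.
have [ab_cvg [A A_gt0 ab_bessel]] := ab_frame.
have [T T_cvg T_near] :=
  perturbed_frame_operator E_separable E_wsc alpha_ge0 perturbation ab_cvg.
have [S [TS ST S_bound]] := near_id_inverse alpha_lt1 T_near alpha_ge0.
have c_gt0 : 0 < (1 - alpha)^-1 by rewrite invr_gt0 subr_gt0.
have M_gt0 : 0 < A + alpha by rewrite ltr_wpDr.
have xy_bessel := perturbed_bessel_bound perturbation ab_bessel.
have S_auto : banach_automorphism S.
  split; first exact: bounded_continuous S_bound.
  by exists T; split=> //; exact: near_id_continuous T_near.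
have [z zE] : exists z : nat -> dual E, forall n u, z n u = y n (S u).
  have /choice[z zE] : forall n, exists g : dual E, forall u, g u = y n (S u).
    move=> n; have [g gE _] := dual_comp_bounded c_gt0 S_bound (y n).
    by exists g.
  by exists z.
exists z, (fun n => S (x n)); split.
- by exists S.
- by exists S.
- exact: (correct_functionals T_cvg xy_bessel M_gt0 c_gt0 S_bound ST zE).
- exact: (correct_vectors T_cvg xy_bessel M_gt0 c_gt0 S_bound TS).
Qed.
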